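(* Let $G$ be a connected graph with order $n(G)$, size $m(G)$ and maximum degree $\Delta(G)$. Then the following hold. (i) $\xi^d(G) - \xi^c(G) \ge 2\big(n(G)-1-\Delta(G)\big)\varepsilon(G)$. Moreover, equality holds if and only if $G$ is a regular graph with $\mathrm{diam}(G)\le 2$. (ii) $\xi^d(G) - \xi^c(G) \le 2n(G)\big(W(G)-m(G)\big) + M_1(G) - DD(G)$. Moreover, equality holds if and only if $G\in \{P_4\}\cup\{CP_{2k}\oplus K_{n(G)-2k} : 0\le k\le n(G)/2\}$.
   Context: All graphs are finite, simple and connected. For a vertex $v$ of $G$: $\deg(v)$ is its degree; $\varepsilon(v)=\max_{u\in V(G)} d(v,u)$ is its eccentricity; $D(v)=\sum_{u\in V(G)} d(v,u)$ is its total distance, where $d$ is the shortest-path distance. Define $\xi^c(G)=\sum_{v}\varepsilon(v)\deg(v)$ (eccentric connectivity index), $\xi^d(G)=\sum_{v}\varepsilon(v)D(v)$ (eccentric distance sum), $DD(G)=\sum_v \deg(v)D(v)$ (degree distance), $\varepsilon(G)=\sum_v \varepsilon(v)$, $W(G)=\sum_{\{u,v\}\subseteq V(G)} d(u,v)$ (Wiener index), $M_1(G)=\sum_v \deg(v)^2$ (first Zagreb index). $\mathrm{diam}(G)$ is the maximum eccentricity. A graph is regular if all vertices have the same degree. $P_4$ is the path on 4 vertices. The cocktail party graph $CP_{2k}$ is obtained from $K_{2k}$ by removing a perfect matching (so $CP_0$ is the empty graph and $CP_2$ consists of two nonadjacent vertices). The join $G\oplus H$ is the disjoint union of $G$ and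 $H$ together with all edges between a vertex of $G$ and a vertex of $H$; $K_j$ is the complete graph on $j$ vertices ($K_0$ empty). *)

(* Defs.v *)
From mathcomp Require Import all_boot all_order all_algebra.
Set Implicit Arguments.
Unset Strict Implicit.
Unset Printing Implicit Defensive.

Record sgraph := SGraph {
  vertex :> finType;
  adj : rel vertex;
  adj_sym : symmetric adj;
  adj_irr : irreflexive adj
}.

(* The empty graph is not considered connected. *)
Definition connected (G : sgraph) : Prop :=
  (0 < #|G|)%N /\ forall u v : G, connect (@adj G) u v.

Definition isomorphic (G H : sgraph) : Prop :=
  exists2 f : G -> H, bijective f & forall u v, adj (f u) (f v) = adj u v.

Section Invariants.
Variable G : sgraph.
Implicit Types u v : G.

Definition gorder : nat := #|G|.

Definition edges : {set {set G}} :=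
  [set A | [exists u, exists v, adj u v && (A == [set u; v])]].

Definition gsize : nat := #|edges|.

Definition walk (k : nat) u v : bool :=
  [exists p : k.-tuple G, path (@adj G) u p && (last u p == v)].

(* Least length of a walk from u to v. A shortest walk is a path, so it has
   length less than #|G|; the value is #|G| when v is unreachable from u. *)
Definition dist u v : nat := find (fun k => walk k u v) (iota 0 #|G|).

Definition deg v : nat := #|[set u | adj v u]|.
Definition ecc v : nat := \max_u dist v u.
Definition total_dist v : nat := \sum_u dist v u.

Definition max_deg : nat := \max_v deg v.
Definition diam : nat := \max_v ecc v.
Definition regular : Prop := forall u v, deg u = deg v.

Definition ecc_connectivity : nat := \sum_v ecc v * deg v.
Definition ecc_dist_sum : nat := \sum_v ecc v * total_dist v.
Definition degree_dist : nat := \sum_v deg v * total_dist v.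
Definition total_ecc : nat := \sum_v ecc v.
Definition zagreb1 : nat := \sum_v deg v ^ 2.

(* The condition selects exactly one of (u, v) and (v, u) for u != v. *)
Definition wiener : nat :=
  \sum_u \sum_(v | (enum_rank u < enum_rank v)%N) dist u v.

End Invariants.

Section Families.

Lemma complete_sym n : symmetric (fun u v : 'I_n => u != v).
Proof. by move=> u v; rewrite eq_sym. Qed.

Lemma complete_irr n : irreflexive (fun u v : 'I_n => u != v).
Proof. by move=> u; rewrite eqxx. Qed.

Definition complete n : sgraph := SGraph (@complete_sym n) (@complete_irr n).

Definition path_adj n (u v : 'I_n) : bool :=
  (u.+1 == v :> nat) || (v.+1 == u :> nat).

Lemma path_adj_sym n : symmetric (@path_adj n).
Proof. by move=> u v; rewrite /path_adj orbC. Qed.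

Lemma path_adj_irr n : irreflexive (@path_adj n).
Proof. by move=> u; rewrite /path_adj orbb eqn_leq ltnn. Qed.

Definition path_graph n : sgraph := SGraph (@path_adj_sym n) (@path_adj_irr n).

(* The perfect matching removed from the complete graph on {0, ..., 2k - 1}
   is {0, 1}, {2, 3}, ..., {2k - 2, 2k - 1}. *)
Definition cocktail_adj k (u v : 'I_k.*2) : bool :=
  (u != v) && (u./2 != v./2).

Lemma cocktail_adj_sym k : symmetric (@cocktail_adj k).
Proof. by move=> u v; rewrite /cocktail_adj eq_sym [u./2 == _]eq_sym. Qed.

Lemma cocktail_adj_irr k : irreflexive (@cocktail_adj k).
Proof. by move=> u; rewrite /cocktail_adj eqxx. Qed.

Definition cocktail_party k : sgraph :=
  SGraph (@cocktail_adj_sym k) (@cocktail_adj_irr k).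

Definition join_adj (G H : sgraph) (x y : G + H) : bool :=
  match x, y with
  | inl u, inl v => adj u v
  | inr u, inr v => adj u v
  | _, _ => true
  end.

Lemma join_adj_sym G H : symmetric (@join_adj G H).
Proof. by move=> [u|u] [v|v] //=; rewrite adj_sym. Qed.

Lemma join_adj_irr G H : irreflexive (@join_adj G H).
Proof. by move=> [u|u] /=; rewrite adj_irr. Qed.

Definition join (G H : sgraph) : sgraph :=
  SGraph (@join_adj_sym G H) (@join_adj_irr G H).

End Families.

(* Main.v *)
(* Write n, deg, ecc, D for order, degree, eccentricity, total distance. Part
   (i) is D v + deg v + 2 = 2 n + \sum_u (d v u - 2), with truncated
   subtraction, weighted by ecc v. For (ii), the two sides differ by
   \sum_v (n - deg v - ecc v) (D v - deg v), whose terms are nonnegative since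
   the non-neighbours of v, v included, realise 0, 2, ..., ecc v as distances.
   Equality means that each v is universal or has exactly one non-neighbour at
   each of these distances. If all eccentricities are at most 2, the complement
   is a matching. Otherwise a vertex w farthest from a vertex of eccentricity
   at least 3 is pendant, so that all the distance levels of w are singletons
   and G is a path; the vertex at distance 2 from w then forces n = 4. *)
Require Import Defs.
From mathcomp Require Import all_boot all_order all_algebra.
From mathcomp Require Import zify ring.
Set Implicit Arguments.
Unset Strict Implicit.
Unset Printing Implicit Defensive.
Local Open Scope nat_scope.

(** * Distances, eccentricities and degrees in a connected graph *)

Section Distance.
Variable G : sgraph.
Hypothesis Gconn : connected G.
Implicit Types u v w x y : G.

Lemma walkP k u v :
  reflect (exists p, [/\ path (@adj G) u p, last u p = v & size p = k])
          (walk k u v).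
Proof.
apply: (iffP existsP) => [[p /andP[pP /eqP pl]]|[p [pP pl sp]]].
  by exists p; rewrite size_tuple.
by exists (tcast sp (in_tuple p)); rewrite val_tcast pP /= pl eqxx.
Qed.

(** The search in [dist] stops below the order; a walk shortened to a duplicate-free path fits in
    this range. *)
Lemma has_dist u v : has (fun k => walk k u v) (iota 0 #|G|).
Proof.
have /connectP[p0 p0P ->] := Gconn.2 u v.
case/shortenP: p0P => p pP p_uniq _.
apply/hasP; exists (size p); last by apply/walkP; exists p.
rewrite mem_iota /= add0n -[_ < _]/(size (u :: p) <= _).
by rewrite -(card_uniqP p_uniq) max_card.
Qed.

Lemma dist_lt_order u v : dist u v < #|G|.
Proof. by rewrite -[ltnRHS](size_iota 0) -has_find has_dist. Qed.

Lemma walk_dist u v : walk (dist u v) u v.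
Proof.
by have := nth_find 0 (has_dist u v); rewrite nth_iota // dist_lt_order.
Qed.

Lemma dist_le_walk k u v : walk k u v -> dist u v <= k.
Proof.
move=> kP; rewrite leqNgt; apply/negP => lt_k.
have := before_find 0 lt_k; rewrite nth_iota ?kP //.
exact: ltn_trans lt_k (dist_lt_order u v).
Qed.

Lemma distxx u : dist u u = 0.
Proof. by apply/eqP; rewrite -leqn0 dist_le_walk //; apply/walkP; exists [::]. Qed.

Lemma dist_eq0 u v : (dist u v == 0) = (u == v).
Proof.
apply/eqP/eqP => [d0|->]; last exact: distxx.
by have := walk_dist u v; rewrite d0 => /walkP[[|a p] []].
Qed.

Lemma dist_triangle v u w : dist u w <= dist u v + dist v w.
Proof.
have /walkP[p [pP pl sp]] := walk_dist u v.
have /walkP[q [qP ql sq]] := walk_dist v w.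
apply/dist_le_walk/walkP; exists (p ++ q).
by rewrite cat_path last_cat pP pl qP ql size_cat sp sq.
Qed.

Lemma dist_sym u v : dist u v = dist v u.
Proof.
suff le_d x y : dist x y <= dist y x by apply/eqP; rewrite eqn_leq !le_d.
have /walkP[p [pP pl sp]] := walk_dist y x.
apply/dist_le_walk/walkP; exists (rev (belast y p)).
split; last by rewrite size_rev size_belast.
  by rewrite -pl rev_path (eq_path (e' := @adj G)) // => a b; rewrite adj_sym.
by case: p pl {pP sp} => [|a p] //= _; rewrite rev_cons last_rcons.
Qed.

Lemma dist_adj u v : adj u v -> dist u v <= 1.
Proof. by move=> uv; apply/dist_le_walk/walkP; exists [:: v]; rewrite /= uv. Qed.

Lemma dist_pred u v k :
  dist u v = k.+1 -> exists2 w, dist u w = k & adj w v.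
Proof.
move=> duv; have /walkP[p [pP pl]] := walk_dist u v; rewrite duv.
case: (lastP p) pP pl => // q a; rewrite rcons_path last_rcons size_rcons.
move=> /andP[qP qa] av [sq]; rewrite av in qa; exists (last u q) => //.
apply/eqP; rewrite eqn_leq; apply/andP; split.
  by apply/dist_le_walk/walkP; exists q.
have := dist_triangle (last u q) u v; have := dist_adj qa; lia.
Qed.

Lemma dist_eq1 u v : (dist u v == 1) = adj u v.
Proof.
apply/eqP/idP => [/dist_pred[w /eqP]|uv]; first by rewrite dist_eq0 => /eqP->.
have := dist_adj uv; case: (eqVneq u v) uv => [->|]; first by rewrite adj_irr.
by rewrite -dist_eq0 => ? _ ?; lia.
Qed.

(** A shortest path meets every level. The reverse bound on [dist w v] is the triangle
    inequality. *)
Lemma dist_geodesic u v k :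
  k <= dist u v -> exists2 w, dist u w = k & dist w v <= dist u v - k.
Proof.
move Ed: (dist u v) => d; elim: d v Ed => [|d IHd] v Ed.
  by rewrite leqn0 => /eqP->; exists v; rewrite ?distxx.
rewrite leq_eqVlt => /predU1P[->|]; first by exists v; rewrite ?distxx.
rewrite ltnS => le_kd; have [w dw wv] := dist_pred Ed.
have [x dx xw] := IHd _ dw le_kd; exists x => //.
have := dist_triangle w x v; have := dist_adj wv; lia.
Qed.

Lemma dist_adj_le w u v : adj u v -> dist w u <= (dist w v).+1.
Proof.
rewrite adj_sym => /dist_adj; have := dist_triangle v w u; lia.
Qed.

Lemma dist_le_ecc v u : dist v u <= ecc v.
Proof. exact: (leq_bigmax (F := dist v)). Qed.

Lemma ecc_attained v : exists u, dist v u = ecc v.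
Proof. by case: (eq_bigmax (dist v) Gconn.1) => u du; exists u. Qed.

(** Bounds distances from below by a potential; used with the position on $P_4$ as [h]. *)
Lemma lipschitz_dist (h : G -> nat) u v :
  (forall x y, adj x y -> h y <= (h x).+1) -> h v <= h u + dist u v.
Proof.
move=> hL; move Ed: (dist u v) => d; elim: d v Ed => [|d IHd] v Ed.
  by move/eqP: Ed; rewrite dist_eq0 => /eqP->; rewrite addn0.
have [w dw /hL wv] := dist_pred Ed; have := IHd _ dw; lia.
Qed.

Lemma deg_sum v : deg v = \sum_u adj v u.
Proof. by rewrite /deg -sum1dep_card big_mkcond. Qed.

Lemma adj_le_dist v u : adj v u <= dist v u.
Proof. by rewrite -dist_eq1; case: eqP => // ->. Qed.

Lemma deg_le_total_dist v : deg v <= total_dist v.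
Proof. by rewrite deg_sum; apply: leq_sum => u _; apply: adj_le_dist. Qed.

Lemma total_dist_eq_deg v :
  (total_dist v == deg v) = [forall u, dist v u <= 1].
Proof.
have -> : total_dist v = deg v + \sum_u (dist v u - adj v u).
  by rewrite deg_sum -big_split /=; apply: eq_bigr => u _; rewrite subnKC ?adj_le_dist.
rewrite -[eqbRHS]addn0 eqn_add2l sum_nat_eq0; apply: eq_forallb => u /=.
by rewrite -dist_eq1; case: (dist v u) => [|[|]].
Qed.

(** Termwise in [u], $d + [d = 1] + 2[d = 0]$ is 2 for $d \le 2$ and $d$ beyond, which is 2 plus the
    truncated $d - 2$. *)
Lemma total_dist_deg v :
  total_dist v + deg v + 2 = 2 * #|G| + \sum_u (dist v u - 2).
Proof.
have sum_v : \sum_u 2 * (u == v) = 2.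
  by rewrite (bigD1 v) //= eqxx big1 // => u /negPf->.
rewrite -[in LHS]sum_v mulnC -sum_nat_const deg_sum -!big_split /=; apply: eq_bigr => u _.
rewrite -dist_eq1 (eq_sym u) -dist_eq0.
by case: (dist v u) => [|[|d]] //=; lia.
Qed.

Lemma ecc_eq0 v : ecc v = 0 -> forall u, u = v.
Proof.
by move=> e0 u; apply/eqP; rewrite eq_sym -dist_eq0 -leqn0 -e0 dist_le_ecc.
Qed.

(** The distances 0, 2, ..., [ecc v] listed in [t] are all realised in [B], which has $n - \deg v$
    elements. In the equality case no distance can occur twice there. *)
Lemma ecc_deg_levels v :
  ecc v + deg v <= #|G|
  /\ (ecc v + deg v = #|G| ->
      {in [pred u | ~~ adj v u] &, injective (dist v)}).
Proof.
set B := [pred u | ~~ adj v u]; set t := 0 :: iota 2 (ecc v).-1.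
have t_uniq : uniq t by rewrite /= iota_uniq mem_iota.
have t_sub : {subset t <= [seq dist v u | u in B]}.
  move=> k k_t; have : k <= ecc v /\ k != 1.
    by move: k_t; rewrite inE mem_iota; lia.
  have [u0 <-] := ecc_attained v => -[/dist_geodesic[u du _] k1].
  by apply/imageP; exists u; rewrite // inE -dist_eq1 du.
have sz_B : deg v + size [seq dist v u | u in B] = #|G|.
  by rewrite size_image /deg cardsE -(cardC (adj v)).
(* Strict only when [ecc v] is 0, since [t] still contains 0. *)
have sz_t : ecc v <= size t by rewrite /= size_iota; lia.
rewrite -sz_B addnC leq_add2l; split.
  exact: leq_trans sz_t (uniq_leq_size t_uniq t_sub).
move=> /addnI ecc_sz; apply/dinjectiveP/(leq_size_uniq t_uniq t_sub).
by rewrite -ecc_sz.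
Qed.

Lemma ecc_deg_le v : ecc v + deg v <= #|G|.
Proof. by case: (ecc_deg_levels v). Qed.

End Distance.

(** * Matching complements, $P_4$, and equality in (ii) *)

Definition conbrs (G : sgraph) (v : G) : {set G} :=
  [set u | (u != v) && ~~ adj v u].

(* The complement of G is a matching. *)
Definition comatching (G : sgraph) : Prop := forall v : G, #|conbrs v| <= 1.

(** Says that every term of the gap in (ii) vanishes; for connected graphs the first alternative
    means that [v] is universal. *)
Definition extremal (G : sgraph) : Prop :=
  forall v : G, total_dist v = deg v \/ ecc v + deg v = #|G|.

Lemma card_conbrs (G : sgraph) (v : G) : (deg v + #|conbrs v|).+1 = #|G|.
Proof.
rewrite -(cardsC [set u | adj v u]) -addnS /deg; congr (_ + _).
rewrite (cardsD1 v (~: _)) !inE adj_irr add1n; congr (#|pred_of_set _|.+1).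
by apply/setP => u; rewrite !inE.
Qed.

Lemma comatching_iso (G H : sgraph) :
  isomorphic G H -> comatching H -> comatching G.
Proof.
move=> [f f_bij f_adj] HM v.
rewrite -(card_imset _ (bij_inj f_bij)); apply: leq_trans (HM (f v)).
apply/subset_leq_card/subsetP => _ /imsetP[u uv ->].
by move: uv; rewrite !inE f_adj (inj_eq (bij_inj f_bij)).
Qed.

(** Non-neighbours occur only on the cocktail party side, where they share the half of [v]; only two
    indices have a given half. *)
Lemma comatching_cocktail k m :
  comatching (join (cocktail_party k) (complete m)).
Proof.
move=> v; apply/card_le1_eqP => a b; rewrite !inE.
case: v a b => v [a|a] [b|b] //; rewrite ?andbF //=; last first.
  by case/andP=> av; rewrite negbK eq_sym => /eqP va; rewrite va eqxx in av.
rewrite /cocktail_adj !(inj_eq (@inl_inj _ _)) ![v == _]eq_sym.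
move=> /andP[av]; rewrite av negbK => /eqP ea.
move=> /andP[bv]; rewrite bv negbK => /eqP eb.
congr inl; apply: val_inj; move: av bv; rewrite -!val_eqE /=; lia.
Qed.

Section Extremal.
Variable G : sgraph.
Hypothesis Gconn : connected G.
Implicit Types u v w x y : G.

(** A vertex with a non-neighbour has degree $n - 2$ and eccentricity at least 2, so [ecc_deg_le] is
    tight. *)
Lemma comatching_extremal : comatching G -> extremal G.
Proof.
move=> GM v; have := GM v; have := card_conbrs v.
have [nv|[u]] := set_0Vmem (conbrs v).
  move=> _ _; left; apply/eqP; rewrite total_dist_eq_deg //.
  apply/forallP => u; have [->|uv] := eqVneq u v; first by rewrite distxx.
  have /negbT := in_set0 u; rewrite -nv inE uv negbK; exact: dist_adj.
rewrite inE => /andP[]; rewrite -dist_eq1 // eq_sym -dist_eq0 // => d0 d1.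
have := dist_le_ecc v u; have := ecc_deg_le Gconn v; right; lia.
Qed.

Lemma path4_extremal : isomorphic G (path_graph 4) -> extremal G.
Proof.
move=> [f f_bij f_adj] v; right.
have cG : #|G| = 4 by rewrite (bij_eq_card f_bij) card_ord.
(* The left side is the absolute difference of positions, in truncated subtraction. *)
have ecc_f w : (f v - f w) + (f w - f v) <= ecc v.
  have f_lip x y : adj x y -> f y <= (f x).+1.
    by rewrite -f_adj /= /path_adj; lia.
  have := dist_le_ecc v w.
  have := lipschitz_dist Gconn v w f_lip.
  have := lipschitz_dist Gconn w v f_lip.
  rewrite (dist_sym Gconn w v); lia.
have degf : deg v = \sum_(i < 4) path_adj (f v) i.
  rewrite deg_sum (reindex f) /=; last exact: onW_bij.
  by apply: eq_bigr => u _; rewrite -f_adj.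
have [g _ fK] := f_bij.
(* The two ends of the path give the lower bound on the eccentricity; [ecc_deg_le] gives the upper
   one. *)
have := ecc_f (g ord0); have := ecc_f (g ord_max); rewrite !fK.
have := ecc_deg_le Gconn v; rewrite cG degf !big_ord_recl big_ord0.
by case: (f v) => [[|[|[|[|]]]]] //= _; lia.
Qed.

Lemma extremal_diam2 :
  extremal G -> (forall v, ecc v <= 2) -> comatching G.
Proof.
move=> Gext ecc2 v; have := ecc2 v; have := card_conbrs v.
case: (Gext v) => [/eqP|]; last lia.
rewrite total_dist_eq_deg // => /forallP d1 _ _.
suff -> : conbrs v = set0 by rewrite cards0.
apply/setP => u; rewrite !inE -dist_eq1 // eq_sym -dist_eq0 //.
have := d1 u; lia.
Qed.

Lemma extremal_far v u :
  extremal G -> 1 < dist v u -> ecc v + deg v = #|G|.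
Proof.
move=> Gext lt_d; case: (Gext v) => // /eqP.
rewrite total_dist_eq_deg // => /forallP/(_ u); lia.
Qed.

(** Take [w] farthest from [v]. Each neighbour of [w] is at distance at least [ecc v - 1] from [v],
    hence not adjacent to [v], and not at distance [ecc v], a level held by [w] alone. So all
    neighbours of [w] share one level, which is a singleton. *)
Lemma extremal_pendant v :
  extremal G -> 2 < ecc v -> exists2 w : G, 2 < ecc w & deg w <= 1.
Proof.
move=> Gext lt2; have [w dw] := ecc_attained Gconn v.
have /(extremal_far Gext)/(ecc_deg_levels Gconn v).2 inj_v : 1 < dist v w by lia.
exists w; first by have := dist_le_ecc w v; rewrite dist_sym // dw; lia.
apply/card_le1_eqP => a b; rewrite !inE.
suff near_w x : adj w x -> ~~ adj v x /\ dist v x = (ecc v).-1.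
  by move=> /near_w[va da] /near_w[vb db]; apply: inj_v; rewrite // da db.
move=> wx; have := dist_adj_le Gconn v wx; rewrite dw -dist_eq1 // => le_x.
have dv1 : dist v x != 1 by lia.
split=> //; have := dist_le_ecc v x.
suff : dist v x != ecc v by lia.
apply/eqP => dx; move: wx; rewrite -(inj_v x w) ?adj_irr //.
- by rewrite inE -dist_eq1.
- by rewrite inE -dist_eq1 // dw -dx.
by rewrite dx dw.
Qed.

Lemma extremal_pendant_path w :
  extremal G -> 2 < ecc w -> deg w <= 1 -> isomorphic G (path_graph 4).
Proof.
move=> Gext lt2 deg1; have [z dz] := ecc_attained Gconn w.
have /(extremal_far Gext) ecc_w : 1 < dist w z by lia.
(* Level 1 is a singleton by the degree bound, the other levels by tightness at [w]. *)
have inj_w : injective (dist w).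
  move=> a b eq_d; have [wa|wa] := boolP (adj w a).
    apply: (card_le1_eqP deg1); rewrite inE //.
    by rewrite -dist_eq1 // -eq_d dist_eq1.
  apply: (ecc_deg_levels Gconn w).2 => //; rewrite inE //.
  by rewrite -dist_eq1 // -eq_d dist_eq1.
have deg_gt0 : 0 < deg w.
  have [|y dy _] := @dist_geodesic _ Gconn w z 1; first by lia.
  by apply/card_gt0P; exists y; rewrite inE -dist_eq1 // dy.
have [|x dx _] := @dist_geodesic _ Gconn w z 2; first by lia.
(* Neighbours of [x] lie on levels 1 and 3 of [w], both singletons. *)
have deg_x : deg x <= 2.
  have [|a da _] := @dist_geodesic _ Gconn w z 1; first by lia.
  have [|b db _] := @dist_geodesic _ Gconn w z 3; first by lia.
  apply: (@leq_trans #|[set a; b]|); last by rewrite cards2; case: eqP.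
  apply/subset_leq_card/subsetP => y; rewrite !inE => xy.
  have := dist_adj_le Gconn w xy; move: (xy); rewrite adj_sym => yx.
  have := dist_adj_le Gconn w yx; rewrite dx.
  have : dist w y != dist w x by apply/eqP => /inj_w yE; rewrite yE adj_irr in xy.
  by rewrite -!(inj_eq inj_w) dx da db; lia.
have ecc_x : ecc x + deg x = #|G|.
  by apply: (@extremal_far _ w) => //; rewrite dist_sym // dx.
have le4 : #|G| <= 4.
  have [u du] := ecc_attained Gconn x.
  (* If [u] is at level 2 or more, a geodesic from [w] to [u] passes through [x], so [ecc x] is at
     most $n - 3$, contradicting [deg_x]. Otherwise a geodesic from [w] to [x] passes through [u],
     so [ecc x] is at most 2. *)
  have := dist_le_ecc w u; have [le_2u|lt_u2] := leqP 2 (dist w u).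
    have [y dy] := dist_geodesic Gconn le_2u.
    have -> : y = x by apply: inj_w; rewrite dy dx.
    lia.
  have [|y dy] := @dist_geodesic _ Gconn w x (dist w u); first by lia.
  have -> : y = u by apply: inj_w.
  rewrite dist_sym //; lia.
have lt4 u : dist w u < 4 by have := dist_le_ecc w u; lia.
have cG : #|G| = 4 by lia.
exists (fun u => Ordinal (lt4 u)).
  by apply: inj_card_bij => [a b [/inj_w]|]; rewrite ?card_ord ?cG.
move=> u v; rewrite /= /path_adj /=; apply/orP/idP.
  (* The predecessor of [b] on a geodesic from [w] has the level of [a], hence is [a]. *)
  suff succ_adj a b : (dist w a).+1 == dist w b -> adj a b.
    by case=> /succ_adj //; rewrite adj_sym.
  move=> /eqP/esym/(dist_pred Gconn)[c /inj_w->].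
  by [].
move=> uv; have := dist_adj_le Gconn w uv; move: (uv); rewrite adj_sym => vu.
have := dist_adj_le Gconn w vu.
have : dist w u != dist w v by apply/eqP => /inj_w uE; rewrite uE adj_irr in uv.
by rewrite neq_ltn => /orP[] lt_d le1 le2; [left | right]; apply/eqP; lia.
Qed.

End Extremal.

(** * Graphs with matching complement as cocktail party joins *)

Section Cocktail.
Variable G : sgraph.
Hypotheses (G_gt0 : 0 < #|G|) (GM : comatching G).
Implicit Types u v : G.

(* The involution matching [v] with its non-neighbour, if it has one. *)
Let p v : G := odflt v [pick u in conbrs v].

Let pE v u : u \in conbrs v -> p v = u.
Proof.
move=> uv; rewrite /p; case: pickP => [x xv|/(_ u)]; last by rewrite uv.
exact: (card_le1_eqP (GM v)).
Qed.

Let adj_p u v : adj u v = (v != u) && (v != p u).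
Proof.
have [->|vu] /= := eqVneq v u; first exact: adj_irr.
have [uv|uv] := boolP (adj u v); last by rewrite (@pE u v) ?eqxx // inE vu.
rewrite /p; case: pickP => [x|_]; rewrite ?vu // inE => /andP[_].
by case: eqVneq uv => // -> ->.
Qed.

Let pK : involutive p.
Proof.
move=> v; case: (pickP [in conbrs v]) => [u uv|v0].
  rewrite (pE uv); apply: pE; move: uv.
  by rewrite !inE eq_sym (adj_sym u).
by have -> : p v = v; rewrite /p; case: pickP => // x; rewrite v0.
Qed.

(** One end of each non-edge, picked by rank; [fixed] collects the universal vertices. *)
Let reps : {set G} := [set v | enum_rank v < enum_rank (p v)].
Let fixed : {set G} := [set v | p v == v].

Let reps_p v : v \in reps -> p v \notin reps.
Proof. by rewrite !inE pK -leqNgt => /ltnW. Qed.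

(** The set [reps] and its image under [p] partition the complement of [fixed]. *)
Let card_reps : #|reps|.*2 + #|fixed| = #|G|.
Proof.
rewrite -addnn -{2}(card_imset reps (inv_inj pK)) -cardsUI.
have -> : reps :&: [set p x | x in reps] = set0.
  apply/setP => v; rewrite in_setI in_set0; apply/andP => -[vR /imsetP[u uR vE]].
  by move: vR; rewrite vE (negPf (reps_p uR)).
rewrite cards0 addn0 -(cardsC fixed) addnC; congr (_ + #|pred_of_set _|).
apply/setP => v.
have p_reps : (v \in [set p x | x in reps]) = (p v \in reps).
  by rewrite -{1}[v]pK (mem_imset _ _ (inv_inj pK)).
rewrite in_setU p_reps !inE pK.
by rewrite -neq_ltn (inj_eq val_inj) (inj_eq enum_rank_inj) eq_sym.
Qed.

Let k := #|reps|.

(** The half of an index selects a representative and its parity selects that vertex or its partner.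
    The default [v0] is never reached, as all indices are in range. *)
Let g (x : join (cocktail_party k) (complete (#|G| - k.*2))) : G :=
  let v0 := enum_val (Ordinal G_gt0) in
  match x with
  | inl i => iter (odd i) p (nth v0 (enum reps) i./2)
  | inr j => nth v0 (enum fixed) j
  end.

Let iter_repE a b (s t : bool) : a \in reps -> b \in reps ->
  (iter s p a == iter t p b) = (a == b) && (s == t).
Proof.
move=> aR bR; have [<-|ab] := eqVneq a b.
  have pa : p a != a by apply: contraNneq (reps_p aR) => ->.
  by case: s; case: t; rewrite /= ?eqxx // 1?[a == _]eq_sym (negPf pa).
have pab : p a != b by apply: contraNneq (reps_p aR) => ->.
have pba : a != p b by apply: contraNneq (reps_p bR) => <-.
case: s; case: t; rewrite /= ?(inj_eq (inv_inj pK));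
  by rewrite (negPf pab, negPf pba, negPf ab).
Qed.

Let iter_rep_fixed a b (s : bool) : a \in reps -> b \in fixed ->
  (iter s p a == b) = false.
Proof.
rewrite !inE => aR /eqP bF; apply/negP => /eqP ab.
have : p a = a by case: s ab => /= ab; move: bF; rewrite -ab ?pK.
by move=> pa; rewrite pa ltnn in aR.
Qed.

Lemma cocktail_iso :
  exists2 k : nat, k.*2 <= #|G|
    & isomorphic G (join (cocktail_party k) (complete (#|G| - k.*2))).
Proof.
exists k; first by rewrite -card_reps leq_addr.
have card_fixed : #|G| - k.*2 = #|fixed| by rewrite -card_reps addKn.
set v0 := enum_val (Ordinal G_gt0).
have half_lt (i : 'I_k.*2) : i./2 < size (enum reps).
  by rewrite -cardE -/k; have := ltn_ord i; lia.
have repsP (i : 'I_k.*2) : nth v0 (enum reps) i./2 \in reps.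
  by rewrite -mem_enum mem_nth.
have fix_lt (j : 'I_(#|G| - k.*2)) : j < size (enum fixed).
  by rewrite -cardE -card_fixed.
have fixedP (j : 'I_(#|G| - k.*2)) : nth v0 (enum fixed) j \in fixed.
  by rewrite -mem_enum mem_nth.
have pfix a : a \in fixed -> p a = a by rewrite inE => /eqP.
have p_iter a (s : bool) : p (iter s p a) = iter (~~ s) p a by case: s => /=.
have g_inj : injective g.
  case=> [i|i] [j|j] /= /eqP.
  - rewrite iter_repE // nth_uniq ?enum_uniq // => /andP[/eqP eh /eqP eo].
    congr inl; apply: val_inj.
    by rewrite /= -(odd_double_half i) eh eo odd_double_half.
  - by rewrite iter_rep_fixed.
  - by rewrite eq_sym iter_rep_fixed.
  - by rewrite nth_uniq ?enum_uniq // => /eqP eij; congr inr; apply: val_inj.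
have g_bij : bijective g.
  apply: inj_card_bij => //; rewrite card_sum !card_ord.
  by rewrite subnKC // -card_reps leq_addr.
(* The isomorphism must start from [G], so it is the inverse of [g]. *)
have [f gK fK] := g_bij; exists f; first by exists g.
move=> u v; rewrite -[u]fK -[v]fK !gK; move: (f u) (f v) => {u v} x y.
rewrite adj_p (inj_eq g_inj) eq_sym.
case: x y => [i|i] [j|j] /=.
- rewrite p_iter iter_repE // nth_uniq ?enum_uniq // /cocktail_adj.
  rewrite (inj_eq (@inl_inj _ _)) (eq_sym j./2).
  case: eqVneq => [->|ij] //=; case: eqP => //= eh; rewrite ?andbT.
  (* Distinct indices with equal halves have opposite parities, hence go to partners. *)
  apply/esym/negbTE; rewrite negbK; apply: contraNT ij => eo.
  rewrite -val_eqE /= -(odd_double_half i) -(odd_double_half j) eh.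
  by move: eo; case: (odd i) (odd j) => [] [].
- by rewrite p_iter eq_sym iter_rep_fixed.
- by rewrite pfix // iter_rep_fixed.
- rewrite pfix // nth_uniq ?enum_uniq // (inj_eq (@inr_inj _ _)) val_eqE.
  by rewrite eq_sym andbb.
Qed.

End Cocktail.

(** * Double counting for the Wiener index and the size *)

Lemma sum_sym_pairs (T : finType) (F : T -> T -> nat) :
  (forall u v, F u v = F v u) -> (forall u, F u u = 0) ->
  \sum_u \sum_v F u v
    = 2 * \sum_u \sum_(v | enum_rank u < enum_rank v) F u v.
Proof.
move=> F_sym F0; rewrite mul2n -addnn.
rewrite [X in _ + X](exchange_big_dep predT) //= -big_split /=.
apply: eq_bigr => u _; rewrite (bigID (fun v => enum_rank u < enum_rank v)) /=.
congr (_ + _); rewrite (bigD1 u) ?ltnn //= F0 add0n.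
apply: eq_big => [v|v _]; last exact: F_sym.
by rewrite -leqNgt ltn_neqAle (inj_eq val_inj) (inj_eq enum_rank_inj) andbC.
Qed.

Section Sums.
Variable G : sgraph.
Hypothesis Gconn : connected G.

Lemma sum_total_dist : \sum_(v : G) total_dist v = 2 * wiener G.
Proof. by apply: sum_sym_pairs => [u v|u]; [apply: dist_sym | apply: distxx]. Qed.

(** Each edge, an unordered pair, is the image of exactly one adjacent pair with increasing
    ranks. *)
Lemma gsize_pairs :
  gsize G = \sum_u \sum_(v | enum_rank u < enum_rank v) @adj G u v.
Proof.
pose A := [set x : G * G | adj x.1 x.2 && (enum_rank x.1 < enum_rank x.2)].
have -> : gsize G = #|[set [set x.1; x.2] | x in A]|.
  rewrite /gsize; congr #|pred_of_set _|; apply/setP => E; rewrite inE.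
  apply/existsP/imsetP => [[u /existsP[v /andP[uv /eqP ->]]]|[[u v]]].
    have := uv; have [lt_uv|lt_vu|/val_inj/enum_rank_inj->] :=
      ltngtP (enum_rank u) (enum_rank v); last by rewrite adj_irr.
      by exists (u, v); rewrite // inE /= uv.
    by exists (v, u); rewrite ?inE /= ?[adj v u]adj_sym ?uv // setUC.
  rewrite inE => /andP[/= uv _] ->; exists u; apply/existsP; exists v.
  by rewrite uv eqxx.
rewrite card_in_imset => [|[u v] [u' v']].
  rewrite -sum1_card pair_big_dep /= [RHS]big_mkcond [LHS]big_mkcond.
  by apply: eq_bigr => -[u v] _; rewrite inE /=; case: adj; case: ltnP.
rewrite !inE /= => /andP[_ lt_uv] /andP[_ lt_uv'] /setP eq_uv.
have := eq_uv v'; have := eq_uv u'; rewrite !inE !eqxx orbT /=.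
move=> /orP[]/eqP uE /orP[]/eqP vE; move: lt_uv'; rewrite uE vE ?ltnn //.
by move=> /(ltn_trans lt_uv); rewrite ltnn.
Qed.

Lemma sum_deg : \sum_(v : G) deg v = 2 * gsize G.
Proof.
rewrite gsize_pairs -sum_sym_pairs => [|u v|u]; rewrite ?adj_irr 1?adj_sym //.
by apply: eq_bigr => v _; rewrite deg_sum.
Qed.

End Sums.

(** * The two inequalities as identities with an explicit gap *)

Section Gaps.
Variable G : sgraph.
Hypothesis Gconn : connected G.

Lemma deg_le_max_deg (v : G) : deg v <= max_deg G.
Proof. exact: (leq_bigmax (F := @deg G)). Qed.

(** Inequality (i) with negative terms moved across, to stay in the naturals; the last sum is the
    slack. *)
Lemma lower_gap :
  ecc_dist_sum G + 2 * (max_deg G).+1 * total_ecc G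
    = ecc_connectivity G + 2 * gorder G * total_ecc G
      + \sum_(v : G) ecc v * (\sum_u (dist v u - 2) + 2 * (max_deg G - deg v)).
Proof.
rewrite /ecc_dist_sum /total_ecc !big_distrr /= -!big_split.
apply: eq_bigr => v _ /=; rewrite /gorder.
have := total_dist_deg Gconn v; move: (\sum_u _) => s tot.
have /subnK := deg_le_max_deg v.
move: (max_deg G - deg v) => c <-.
have -> : 2 * #|G| * ecc v = (2 * #|G| + s) * ecc v - s * ecc v.
  by rewrite mulnDl addnK.
rewrite -tot; nia.
Qed.

(** Doubled [wiener] and [gsize] are sums of total distances and degrees, so the identity is checked
    at each vertex, after writing $D = \deg + a$ and $n = \varepsilon + \deg + b$. *)
Lemma upper_gap :
  ecc_dist_sum G + degree_dist G + 2 * gorder G * gsize G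
      + \sum_(v : G) (#|G| - deg v - ecc v) * (total_dist v - deg v)
    = ecc_connectivity G + 2 * gorder G * wiener G + zagreb1 G.
Proof.
rewrite -!mulnA ![2 * (gorder G * _)]mulnCA -sum_deg -sum_total_dist //.
rewrite !big_distrr /= -!big_split; apply: eq_bigr => v _ /=; rewrite /gorder.
have := ecc_deg_le Gconn v; have := deg_le_total_dist Gconn v.
move=> /subnK; move: (total_dist v - deg v) => a <- le_n.
have -> : #|G| - deg v - ecc v = #|G| - (ecc v + deg v) by lia.
rewrite -{1 3}(subnK le_n); move: (#|G| - (ecc v + deg v)) => b.
by ring.
Qed.

Lemma lower_gap_eq0 :
  \sum_(v : G) ecc v * (\sum_u (dist v u - 2) + 2 * (max_deg G - deg v)) = 0
    <-> regular G /\ diam G <= 2.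
Proof.
split=> [/eqP|[Greg diam2]].
  rewrite sum_nat_eq0 => /forallP /= gap0; split.
    have deg_max (v : G) : ecc v != 0 -> deg v = max_deg G.
      move=> ev; have := gap0 v; rewrite muln_eq0 (negPf ev) addn_eq0 /=.
      have := deg_le_max_deg v; lia.
    (* A zero weight [ecc u] hides the degree of [u], but then [G] has a single vertex. *)
    move=> u v; have [/(ecc_eq0 Gconn) eu|eu] := eqVneq (ecc u) 0.
      by rewrite (eu v).
    have [/(ecc_eq0 Gconn) ev|ev] := eqVneq (ecc v) 0; first by rewrite (ev u).
    by rewrite !deg_max.
  apply/bigmax_leqP => v _; apply/bigmax_leqP => u _.
  have := gap0 v; rewrite muln_eq0 addn_eq0 => /orP[/eqP e0|/andP[]].
    by have := dist_le_ecc v u; rewrite e0; lia.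
  by rewrite sum_nat_eq0 => /forallP/(_ u) /=; lia.
apply/eqP; rewrite sum_nat_eq0; apply/forallP => v /=.
have [w maxE] := eq_bigmax (@deg G) Gconn.1.
rewrite /max_deg maxE (Greg w v) subnn addn0.
rewrite muln_eq0 sum_nat_eq0; apply/orP; right; apply/forallP => u /=.
rewrite subn_eq0 (leq_trans (dist_le_ecc v u)) // (leq_trans _ diam2) //.
exact: (leq_bigmax (F := @ecc G)).
Qed.

Lemma upper_gap_eq0 :
  \sum_(v : G) (#|G| - deg v - ecc v) * (total_dist v - deg v) = 0
    <-> extremal G.
Proof.
split=> [/eqP|Gext].
  rewrite sum_nat_eq0 => /forallP gap0 v; have := gap0 v.
  have := ecc_deg_le Gconn v; have := deg_le_total_dist Gconn v.
  by rewrite muln_eq0 => ? ? /orP[] ?; [right | left]; lia.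
apply/eqP; rewrite sum_nat_eq0; apply/forallP => v; rewrite muln_eq0.
by case: (Gext v) => [->|<-]; rewrite ?addnK subnn ?orbT.
Qed.

Lemma extremalP :
  extremal G <-> isomorphic G (path_graph 4)
    \/ exists2 k : nat, k.*2 <= gorder G
         & isomorphic G
             (join (cocktail_party k) (complete (gorder G - k.*2))).
Proof.
split=> [Gext|[/path4_extremal|[k _ /comatching_iso GM]]]; last first.
- by apply: comatching_extremal => //; apply/GM/comatching_cocktail.
- exact.
have [ecc2|/forallPn[v lt2]] := boolP [forall v : G, ecc v <= 2]; [right | left].
  apply: (cocktail_iso Gconn.1 (extremal_diam2 Gconn Gext _)) => v.
  exact: (forallP ecc2).
move: lt2; rewrite -ltnNge => /(extremal_pendant Gconn Gext)[w].
exact: extremal_pendant_path.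
Qed.

End Gaps.

Import Order.TTheory GRing.Theory Num.Theory.
Local Open Scope ring_scope.

Theorem theorem2p1 (G : sgraph) (Gconn : connected G) :
  [/\ 2 * ((gorder G)%:Z - 1 - (max_deg G)%:Z) * (total_ecc G)%:Z
        <= (ecc_dist_sum G)%:Z - (ecc_connectivity G)%:Z,
      (ecc_dist_sum G)%:Z - (ecc_connectivity G)%:Z
        = 2 * ((gorder G)%:Z - 1 - (max_deg G)%:Z) * (total_ecc G)%:Z
      <-> regular G /\ (diam G <= 2)%N,
      (ecc_dist_sum G)%:Z - (ecc_connectivity G)%:Z
        <= 2 * (gorder G)%:Z * ((wiener G)%:Z - (gsize G)%:Z)
           + (zagreb1 G)%:Z - (degree_dist G)%:Z
    & (ecc_dist_sum G)%:Z - (ecc_connectivity G)%:Z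
        = 2 * (gorder G)%:Z * ((wiener G)%:Z - (gsize G)%:Z)
          + (zagreb1 G)%:Z - (degree_dist G)%:Z
      <-> isomorphic G (path_graph 4)
          \/ exists2 k : nat, (k.*2 <= gorder G)%N
             & isomorphic G
                 (join (cocktail_party k) (complete (gorder G - k.*2)%N))].
Proof.
have lowE := lower_gap Gconn; have low0 := lower_gap_eq0 Gconn.
have uppE := upper_gap Gconn.
have upp0 := iff_trans (upper_gap_eq0 Gconn) (extremalP Gconn).
(* With the gaps named, each inequality says that a natural number is nonnegative, and each equality
   that it is 0. *)
move: lowE low0 uppE upp0; set s := (\sum_v _)%N; set t := (\sum_v _)%N.
move=> lowE low0 uppE upp0; split; first lia.
- by apply: iff_trans low0; split; lia.
- lia.
- by apply: iff_trans upp0; split; lia.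
Qed.
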